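(* Let $M$ be a Calabi-Yau supermanifold with Levi-Civita connection $\nabla$, let $\nabla^{\mathrm{Ber}}$ be the connection on $\mathrm{Ber}\,M$ induced by $\nabla$, and let $\omega\in\mathrm{Ber}\,M$ be the global nowhere vanishing homogeneous holomorphic section that is parallel with respect to $\nabla^{\mathrm{Ber}}$ (unique up to a complex number). Let $\Delta=\Delta^\omega$ be the operator associated with $\omega$ and let $\nabla^\Delta$ be the connection on $\mathrm{Ber}\,M$ determined by $\Delta$ via $\nabla^\Delta_{\partial_{\xi^k}}[d\xi]=-\Delta(\partial_{\xi^k})\cdot[d\xi]$. Then $\nabla^{\mathrm{Ber}}=\nabla^\Delta$. In particular, in local holomorphic coordinates $(\xi^k)$, $$\Delta(\partial_{\xi^k})=\mathrm{str}\left(\jmath\circ\nabla_{\frac{\partial}{\partial\xi^k}}\circ\jmath^{-1}\right).$$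
   Context: Calabi-Yau supermanifolds. Let $(M,g)$ be a connected semi-Riemannian supermanifold with Levi-Civita connection $\nabla$ on $\mathcal TM$. For a topological point $x\in M_{\overline 0}$ and a superpoint $T=\mathbb R^{0|L'}$, let $x_T:T\to M$ be $x$ viewed as a $T$-point and let $\mathrm{Hol}_x(T)$ be the group of parallel transport operators $P_\gamma:x_T^*\mathcal TM\to x_T^*\mathcal TM$ along piecewise smooth $T$-loops $\gamma:T\times[0,1]\to M$ starting and ending at $x_T$ (solutions of $(\gamma^*\nabla)_{\partial_t}P_\gamma[X]=0$). $(M,g)$ is Kähler if $\mathrm{Hol}_x(T)\subseteq U_{p_0,q_0|p_1,q_1}(\mathcal O_T)$ for all such $T$ at some $x$, where the unitary supergroup consists of the even $\mathcal O_T$-linear automorphisms of $x_T^*\mathcal TM=\mathcal O_T\otimes T_xM$ preserving the metric and a metric-compatible complex structure, and $(p_0,q_0)$, $(p_1,q_1)$ are the signatures in the even/even and odd/odd directions. Equivalently, $M$ is Hermitian with a parallel complex structure, $\nabla J=0$; $M$ is then regarded as a complex supermanifold of dimension $n|m$. $M$ is Calabi-Yau if moreover $\mathrm{Hol}_x(T)\subseteq SU_{p_0,q_0|p_1,q_1}(\mathcal O_T)$, the subgroup where the complex superdeterminant $\mathrm{sdet}(\jmath\circ P\circ\jmath^{-1})$ equals $1$. Notation. $(\xi^k)$ are local holomorphic coordinates, with real coordinates $\xi^k_R=\frac12(\xi^k+\overline\xi^k)$, $\xi^k_I=\frac1{2i}(\xi^k-\overline\xi^k)$. $\mathcal T^{1,0}M$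 is the holomorphic tangent sheaf, locally spanned by $\partial_{\xi^k}$. $\jmath:(\mathcal TM,J)\to(\mathcal T^{1,0}M,i)$, $X\mapsto\frac12(X-iJX)$, is the canonical complex-linear isomorphism, $\jmath(\partial_{\xi^k_R})=\partial_{\xi^k}$, $\jmath(\partial_{\xi^k_I})=i\partial_{\xi^k}$. The connection $\jmath\circ\nabla\circ\jmath^{-1}$ on $\mathcal T^{1,0}M$ is extended complex linearly in the direction; $\mathrm{str}(\jmath\circ\nabla_{\partial/\partial\xi^k}\circ\jmath^{-1})$ is the supertrace of its connection matrix $(A_k)^q{}_l$ in the coordinate frame, $\nabla_{\partial_{\xi^k}}\partial_{\xi^l}=\sum_q\partial_{\xi^q}\cdot(A_k)^q{}_l$, i.e. $\sum_q(-1)^{|\xi^q|(|\xi^k|+1)}(A_k)^q{}_q$. Canonical bundle. $\mathrm{Ber}\,M:=\mathrm{Ber}(\mathcal T^{1,0}M)^*$, with local generator $[d\xi]$ of parity $m$, $\varphi^\star[d\xi]=\mathrm{sdet}(d\varphi)[d\zeta]$ under a coordinate change $\varphi:\zeta\to\xi$. The induced connection is $\nabla^{\mathrm{Ber}}_{\partial_{\xi^l}}[d\xi]:=-\mathrm{str}(\jmath\circ\nabla_{\partial/\partial\xi^l}\circ\jmath^{-1})\cdot[d\xi]$ (and by the same formula for all tangent directions), together with the Leibniz rule. The connection $\nabla^\Delta$ is given by $\nabla^\Delta_{\partial_{\xi^k_R}}[d\xi]=-\Delta(\partial_{\xi^k})[d\xi]$, $\nabla^\Delta_{\partial_{\xi^k_I}}[d\xi]=-i\Delta(\partial_{\xi^k})[d\xi]$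 and the Leibniz rule. The operator $\Delta^\omega$. Integral forms are $I^{n-p}:=\bigwedge^p\mathcal T^{1,0}M\otimes\mathrm{Ber}\,M$, with the coordinate-independent operator $\partial:I^{n-p}\to I^{n-p+1}$, $\partial(f\,\partial_{\xi^{k_1}}\wedge\dots\wedge\partial_{\xi^{k_p}}\otimes[d\xi])=\sum_{i=1}^p(-1)^{M_i}\frac{\partial f}{\partial\xi^{k_i}}\,\partial_{\xi^{k_1}}\wedge\dots\widehat{\partial_{\xi^{k_i}}}\dots\wedge\partial_{\xi^{k_p}}\otimes[d\xi]$, $M_i=(i-1)+|\xi^{k_i}|(\sum_{j<i}|\xi^{k_j}|+|f|)$, extended to $\Omega^{0,q}(I^{n-p})=\Omega^{0,q}M\otimes I^{n-p}$ by $\partial(d\overline\xi^I\otimes e)=(-1)^q d\overline\xi^I\otimes\partial e$. With $\eta(v_1\wedge\dots\wedge v_p)=(v_1\wedge\dots\wedge v_p)\otimes\omega$, extended to $\eta:\Omega^{0,q}(\bigwedge^p\mathcal T^{1,0}M)\to\Omega^{0,q}(I^{n-p})$, set $\Delta^\omega:=\eta^{-1}\circ\partial\circ\eta$. *)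

(* Defs.v *)
From HB Require Import structures.
From mathcomp Require Import all_boot all_order all_algebra.

Set Implicit Arguments.
Unset Strict Implicit.
Unset Printing Implicit Defensive.

Import Order.TTheory GRing.Theory Num.Theory.

Local Open Scope ring_scope.

(* The Grassmann algebra on [m] odd generators: [gcoef a S] is the coefficient of the
   product of the generators indexed by [S], taken in increasing order. *)
Definition gr (K : comNzRingType) (m : nat) := {ffun {set 'I_m} -> K^o}.

HB.instance Definition _ (K : comNzRingType) m :=
  GRing.Lmodule.copy (gr K m) {ffun {set 'I_m} -> K^o}.

Section GrRing.
Variables (K : comNzRingType) (m : nat).
Implicit Types (a b c : gr K m) (A B C S : {set 'I_m}).

(* theta_A * theta_B = (-1) ^ (inversions A B) * theta_(A u B) for disjoint A, B. *)
Definition inversions A B : nat := \sum_(i in A) \sum_(j in B) (j < i)%N.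

Definition gcoef a S : K := (a : {ffun {set 'I_m} -> K^o}) S.

Definition grone : gr K m := [ffun S => (S == set0)%:R].

Definition grmul a b : gr K m :=
  [ffun S : {set 'I_m} => \sum_(A : {set _} | A \subset S)
     (-1) ^+ inversions A (S :\: A) * gcoef a A * gcoef b (S :\: A)].

Lemma grP a b : (forall S, gcoef a S = gcoef b S) -> a = b.
Proof. by move=> h; apply/ffunP. Qed.

Lemma gcoefD a b S : gcoef (a + b) S = gcoef a S + gcoef b S.
Proof. by rewrite /gcoef ffunE. Qed.

Lemma gcoef1 S : gcoef grone S = (S == set0)%:R.
Proof. by rewrite /gcoef ffunE. Qed.

Lemma gcoefM a b S : gcoef (grmul a b) S = \sum_(A : {set _} | A \subset S)
     (-1) ^+ inversions A (S :\: A) * gcoef a A * gcoef b (S :\: A).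
Proof. by rewrite /gcoef ffunE. Qed.

Lemma gcoefZ (k : K) a S : gcoef (k *: a) S = k * gcoef a S.
Proof. by rewrite /gcoef ffunE. Qed.

Lemma inversionsUl A B C :
  [disjoint A & B] -> inversions (A :|: B) C = (inversions A C + inversions B C)%N.
Proof.
by move=> d; rewrite /inversions -bigU //; apply: eq_bigl => i; rewrite !inE.
Qed.

Lemma inversionsUr A B C :
  [disjoint B & C] -> inversions A (B :|: C) = (inversions A B + inversions A C)%N.
Proof.
move=> d; rewrite /inversions -big_split; apply: eq_bigr => i _ /=.
by rewrite -bigU //; apply: eq_bigl => j; rewrite !inE.
Qed.

Lemma setU_setD A B : A \subset B -> A :|: B :\: A = B.
Proof.
move=> /subsetP s; apply/setP => x; rewrite !inE.
by case: (boolP (x \in A)) => // /s ->.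
Qed.

Lemma disjoint_setD A B C : A \subset C -> [disjoint A & B :\: C].
Proof.
move=> sAC; rewrite -setI_eq0; apply/eqP/setP => x; rewrite !inE.
by case: (boolP (x \in A)) => // /(subsetP sAC) ->; rewrite ?andbF.
Qed.

Lemma grmulA : associative grmul.
Proof.
move=> a b c; apply: grP => S; rewrite !gcoefM.
pose F (B A : {set 'I_m}) : K :=
  (-1) ^+ (inversions B (A :\: B) + inversions B (S :\: A)
           + inversions (A :\: B) (S :\: A))
  * gcoef a B * gcoef b (A :\: B) * gcoef c (S :\: A).
transitivity (\sum_(B : {set _} | B \subset S)
    \sum_(A : {set _} | (B \subset A) && (A \subset S)) F B A).
  apply: eq_bigr => B sBS; rewrite gcoefM mulr_sumr.
  rewrite [RHS](reindex_onto (fun C => B :|: C) (fun A => A :\: B)) /=; last first.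
    by move=> A /andP[sBA _]; rewrite setU_setD.
  apply: eq_big => [C|C sC].
    rewrite subsetUl subUset sBS /= setDUl setDv set0U.
    rewrite subsetD; congr (_ && _).
    rewrite -setI_eq0; apply/eqP/eqP => [h|h].
      by apply/setDidPl; rewrite -setI_eq0 h.
    by move/setDidPl: h; rewrite -setI_eq0 => /eqP.
  have dBC : [disjoint B & C].
    by move: sC; rewrite subsetD disjoint_sym => /andP[].
  have eC : (B :|: C) :\: B = C.
    by rewrite setDUl setDv set0U; apply/setDidPl; rewrite disjoint_sym.
  rewrite /F eC setDDl.
  have -> : inversions B (S :\: B) =
      (inversions B C + inversions B (S :\: (B :|: C)))%N.
    rewrite -inversionsUr -?setDDl; last first.
      by rewrite disjoint_setD ?subxx.
    by congr (inversions _ _); rewrite setU_setD.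
  rewrite !exprD; set x := gcoef a B; set y := gcoef b C; set z := gcoef c _.
  rewrite -!mulrA; congr (_ * (_ * _)).
  by rewrite mulrCA.
rewrite (exchange_big_dep (fun A => A \subset S)) /=; last first.
  by move=> ? ? _ /andP[].
apply: eq_bigr => A sAS; rewrite gcoefM mulr_sumr mulr_suml.
apply: eq_big => [B|B /andP[_ /andP[sBA _]]].
  rewrite sAS andbT andbC; apply/andP/idP => [[]//|sBA]; split=> //.
  exact: subset_trans sBA sAS.
have dBA : [disjoint B & A :\: B] by exact: disjoint_setD.
have -> : inversions A (S :\: A) =
    (inversions B (S :\: A) + inversions (A :\: B) (S :\: A))%N.
  by rewrite -inversionsUl // setU_setD.
rewrite /F !exprD -!mulrA mulrCA; congr (_ * _).
by rewrite mulrCA.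
Qed.

Lemma inversions0l A : inversions set0 A = 0%N.
Proof. by rewrite /inversions big_set0. Qed.

Lemma inversions0r A : inversions A set0 = 0%N.
Proof. by rewrite /inversions big1 // => i _; rewrite big_set0. Qed.

Lemma grmul1r : left_id grone grmul.
Proof.
move=> a; apply: grP => S; rewrite gcoefM (bigD1 set0) ?sub0set //= big1 ?addr0.
  by rewrite setD0 inversions0l gcoef1 eqxx expr0 !mul1r.
by move=> A /andP[_ /negPf nA]; rewrite gcoef1 nA mulr0 mul0r.
Qed.

Lemma grmulr1 : right_id grone grmul.
Proof.
move=> a; apply: grP => S; rewrite gcoefM (bigD1 S) //= big1 ?addr0.
  by rewrite setDv inversions0r gcoef1 eqxx expr0 mul1r mulr1.
move=> A /andP[sAS nA]; rewrite gcoef1 setD_eq0.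
have /negPf-> : ~~ (S \subset A).
  by apply: contra nA => sSA; rewrite eqEsubset sAS.
by rewrite mulr0.
Qed.

Lemma grmulDl : left_distributive grmul +%R.
Proof.
move=> a b c; apply: grP => S; rewrite gcoefD !gcoefM -big_split.
by apply: eq_bigr => A _; rewrite gcoefD mulrDr mulrDl.
Qed.

Lemma grmulDr : right_distributive grmul +%R.
Proof.
move=> a b c; apply: grP => S; rewrite gcoefD !gcoefM -big_split.
by apply: eq_bigr => A _; rewrite gcoefD mulrDr.
Qed.

Lemma grone_neq0 : grone != 0.
Proof.
apply/eqP => /(congr1 (gcoef^~ set0)).
by rewrite gcoef1 eqxx /gcoef ffunE => /eqP; rewrite oner_eq0.
Qed.

HB.instance Definition _ := GRing.Zmodule_isNzRing.Build (gr K m)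
  grmulA grmul1r grmulr1 grmulDl grmulDr grone_neq0.

Lemma grscaleAl (k : K) a b : k *: (a * b) = k *: a * b.
Proof.
apply: grP => S; rewrite gcoefZ !gcoefM mulr_sumr.
by apply: eq_bigr => A _; rewrite gcoefZ !mulrA [_ * k]mulrC.
Qed.

HB.instance Definition _ := GRing.Lmodule_isLalgebra.Build K (gr K m) grscaleAl.

Lemma grscaleAr (k : K) a b : k *: (a * b) = a * (k *: b).
Proof.
apply: grP => S; rewrite gcoefZ !gcoefM mulr_sumr.
by apply: eq_bigr => A _; rewrite gcoefZ mulrCA.
Qed.

HB.instance Definition _ := GRing.Lalgebra_isAlgebra.Build K (gr K m) grscaleAr.

End GrRing.

Section GrOps.
Variables (K : comNzRingType) (m : nat).
Implicit Types a : gr K m.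

Definition gbody a : K := gcoef a set0.

Definition gnil a : gr K m := a - (gbody a)%:A.

(* 0 is homogeneous of both parities. *)
Definition ghomog (p : bool) a := forall S, gcoef a S != 0 -> odd #|S| = p.

(* a |-> (-1) ^ (p |a|) a, extended additively to inhomogeneous elements. *)
Definition ginvol (p : bool) a : gr K m :=
  [ffun S : {set 'I_m} => (-1) ^+ (p && odd #|S|) * gcoef a S].

Definition gtheta (j : 'I_m) : gr K m := [ffun S => (S == [set j])%:R].

(* Left derivative with respect to the generator [j]. *)
Definition gderiv (j : 'I_m) a : gr K m :=
  [ffun S : {set 'I_m} =>
     if j \in S then 0
     else (-1) ^+ inversions [set j] S * gcoef a (j |: S)].

End GrOps.

(* Inverse of an element with nonzero body, by the (finite) geometric series. *)
Definition ginv (K : fieldType) (m : nat) (a : gr K m) : gr K m :=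
  \sum_(k < m.+1) (gbody a)^-1 ^+ k.+1 *: (- gnil a) ^+ k.

(* Coordinates and homogeneous bases of dimension n|m are indexed by 'I_(n + m),
   even indices first. *)
Definition par (n m : nat) (a : 'I_(n + m)) : bool := (n <= a)%N.

Section SuperLinear.
Variables (K : fieldType) (L n m : nat).
Notation G := (gr K L).

(* Row vectors hold left coefficients: if f(e_k) = \sum_q X k q * e_q then
   f(e_k) = \sum_q e_q * (right_coef X) q k. *)
Definition right_coef (X : 'M[G]_(n + m)) : 'M[G]_(n + m) :=
  \matrix_(q, k) ginvol (par q) (X k q).

(* Superdeterminant of an even matrix of right coefficients.  The entries of
   its diagonal blocks are even, hence commute. *)
Definition sdet (A : 'M[G]_(n + m)) : G :=
  \det (ulsubmx A - ursubmx A *m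
          (ginv (\det (drsubmx A)) *: \adj (drsubmx A)) *m dlsubmx A)
  * ginv (\det (drsubmx A)).

(* Supertrace of a matrix of right coefficients, of parity [p]. *)
Definition str (p : bool) (A : 'M[G]_(n + m)) : G :=
  \sum_q (-1) ^+ (par q && ~~ p) * A q q.

(* Value on (X, Y) of the even bilinear form with Gram matrix [g]; it is left
   linear in X, and Y^b passes the a-th basis vector. *)
Definition gform (g : 'M[G]_(n + m)) (X Y : 'rV[G]_(n + m)) : G :=
  \sum_a \sum_b X 0 a * ginvol (par a) (Y 0 b) * g a b.

End SuperLinear.

From mathcomp Require Import boolp classical_sets functions reals topology.
From mathcomp Require Import normedtype derive.
From mathcomp Require Import complex.

Import numFieldNormedType.Exports.

Local Open Scope classical_set_scope.
Local Open Scope complex_scope.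

Section SuperCalculus.
Variable R : realType.
Notation C := R[i].

Definition gconj L (a : gr C L) : gr C L := [ffun S => conjc (gcoef a S)].

Definition greal L (a : gr C L) := gconj a = a.

(* Partial derivatives of functions on R^n, through one-variable derivatives so
   that n = 0 is allowed. *)
Definition rpartial n (i : 'I_n) (f : 'rV[R]_n -> R) (x : 'rV[R]_n) : R :=
  derive1 (fun t : R => f (x + t *: delta_mx 0 i)) 0.

Definition rpartials n (w : seq 'I_n) (f : 'rV[R]_n -> R) : 'rV[R]_n -> R :=
  foldr (@rpartial n) f w.

Definition rsmooth n (V : set 'rV[R]_n) (f : 'rV[R]_n -> R) :=
  forall (w : seq 'I_n) x, V x ->
    {for x, continuous (rpartials w f)} /\
    forall i, derivable (fun t : R => rpartials w f (x + t *: delta_mx 0 i)) 0 1.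

Definition cpartial n (i : 'I_n) (f : 'rV[R]_n -> C) (x : 'rV[R]_n) : C :=
  rpartial i (fun y => complex.Re (f y)) x +i*
  rpartial i (fun y => complex.Im (f y)) x.

Definition cpartials n (al : 'I_n -> nat) (f : 'rV[R]_n -> C) : 'rV[R]_n -> C :=
  foldr (fun i => iter (al i) (cpartial i)) f (enum 'I_n).

(* Complex-valued superfunctions on R^{n|m} are maps F : 'rV[R]_n -> gr C m;
   the real ones are those with F x real. *)

Definition ssmooth n m (V : set 'rV[R]_n) (F : 'rV[R]_n -> gr C m) :=
  forall S, rsmooth V (fun x => complex.Re (gcoef (F x) S)) /\
            rsmooth V (fun x => complex.Im (gcoef (F x) S)).

(* d/dx^a for a coordinate of R^{n|m}; left derivative for odd a. *)
Definition spartial n m (a : 'I_(n + m)) (F : 'rV[R]_n -> gr C m)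
    (x : 'rV[R]_n) : gr C m :=
  match fintype.split a with
  | inl i => [ffun S => cpartial i (fun y => gcoef (F y) S) x]
  | inr j => gderiv j (F x)
  end.

(* A point of R^{n|m} with values in the Grassmann algebra on L generators, i.e.
   a morphism R^{0|L} -> R^{n|m}, is given by its n even and m odd coordinates.
   The same data depending on x (with L odd coordinates) or on a real parameter t
   describe a morphism from a superdomain, resp. from R^{0|L} x [0,1]. *)
Definition is_point n m L (p : 'rV[gr C L]_(n + m)) :=
  forall a, ghomog (par a) (p 0 a) /\ greal (p 0 a).

Definition base n m L (p : 'rV[gr C L]_(n + m)) : 'rV[R]_n :=
  \row_i complex.Re (gbody (p 0 (lshift m i))).

Definition coords n m (x : 'rV[R]_n) : 'rV[gr C m]_(n + m) :=
  \row_a match fintype.split a with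
         | inl i => ((x 0 i)%:C)%:A
         | inr j => gtheta C j
         end.

(* A topological point, as a point over R^{0|L}. *)
Definition tpoint n m L (x : 'rV[R]_n) : 'rV[gr C L]_(n + m) :=
  \row_a match fintype.split a with
         | inl i => ((x 0 i)%:C)%:A
         | inr _ => 0
         end.

(* Pullback of the superfunction F along the point p: Taylor expansion of the
   coefficients around [base p].  Orders above L do not contribute since even
   nilpotents of [gr C L] vanish to the power L.+1. *)
Definition pull n m L (F : 'rV[R]_n -> gr C m) (p : 'rV[gr C L]_(n + m)) :
    gr C L :=
  \sum_(S : {set 'I_m}) \sum_(al : {ffun 'I_n -> 'I_L.+1})
    ((\prod_i (al i)`!%:R)^-1 *
       cpartials (fun i => nat_of_ord (al i)) (fun y => gcoef (F y) S) (base p))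
    *: ((\prod_i gnil (p 0 (lshift m i)) ^+ al i) *
        \prod_(j in S) p 0 (rshift n j)).

Definition pullmx n m L r s (F : 'rV[R]_n -> 'M[gr C m]_(r, s))
    (p : 'rV[gr C L]_(n + m)) : 'M[gr C L]_(r, s) :=
  \matrix_(a, b) pull (fun x => F x a b) p.

(* X = \sum_a X^a d/dx^a is stored as the row of its left coefficients. *)
Definition vact n m (X : 'rV[R]_n -> 'rV[gr C m]_(n + m))
    (F : 'rV[R]_n -> gr C m) (x : 'rV[R]_n) : gr C m :=
  \sum_a X x 0 a * spartial a F x.

Definition vsmooth n m (V : set 'rV[R]_n) (X : 'rV[R]_n -> 'rV[gr C m]_(n + m)) :=
  forall a, ssmooth V (fun x => X x 0 a).

Definition vhomog n m (V : set 'rV[R]_n) (p : bool)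
    (X : 'rV[R]_n -> 'rV[gr C m]_(n + m)) :=
  forall x a, V x -> ghomog (p (+) par a) (X x 0 a).

(* Supercommutator of vector fields of parities p and q. *)
Definition bracket n m (p q : bool) (X Y : 'rV[R]_n -> 'rV[gr C m]_(n + m))
    (x : 'rV[R]_n) : 'rV[gr C m]_(n + m) :=
  \row_a (vact X (fun y => Y y 0 a) x
          - (-1) ^+ (p && q) * vact Y (fun y => X y 0 a) x).

(* Covariant derivative with Christoffel symbols Gam b x a c, i.e.
   nabla_{d_b} d_a = \sum_c (Gam b x a c) d_c. *)
Definition nabla n m (Gam : 'I_(n + m) -> 'rV[R]_n -> 'M[gr C m]_(n + m))
    (X Y : 'rV[R]_n -> 'rV[gr C m]_(n + m)) (x : 'rV[R]_n) :
    'rV[gr C m]_(n + m) :=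
  \row_c \sum_b X x 0 b *
    (spartial b (fun y => Y y 0 c) x
     + \sum_a ginvol (par b) (Y x 0 a) * Gam b x a c).

(* The projection X |-> (X - i J X) / 2, applied to each row. *)
Definition jmap r N L (J : 'M[gr C L]_N) (X : 'M[gr C L]_(r, N)) :
    'M[gr C L]_(r, N) :=
  map_mx (GRing.scale (2%:R^-1 : C)) (X - map_mx (GRing.scale 'i) (X *m J)).

End SuperCalculus.

(* A supermanifold of dimension n|m, by an atlas: [sm_trans i j] expresses the
   coordinates of chart j as superfunctions of the coordinates of chart i. *)
Record supermanifold (R : realType) (n m : nat) := Supermanifold {
  sm_space :> topologicalType;
  sm_hausdorff : hausdorff_space sm_space;
  sm_countable : @second_countable sm_space;
  chart : Type;
  dom : chart -> set sm_space;
  img : chart -> set 'rV[R]_n;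
  phi : chart -> sm_space -> 'rV[R]_n;
  psi : chart -> 'rV[R]_n -> sm_space;
  dom_open : forall i, open (dom i);
  img_open : forall i, open (img i);
  dom_cover : forall p, exists i, dom i p;
  phi_img : forall i p, dom i p -> img i (phi i p);
  psi_dom : forall i x, img i x -> dom i (psi i x);
  phiK : forall i p, dom i p -> psi i (phi i p) = p;
  psiK : forall i x, img i x -> phi i (psi i x) = x;
  phi_continuous : forall i p, dom i p -> {for p, continuous (phi i)};
  psi_continuous : forall i x, img i x -> {for x, continuous (psi i)};
  sm_trans : chart -> chart -> 'rV[R]_n -> 'rV[gr R[i] m]_(n + m);
  trans_smooth : forall i j a,
    ssmooth (img i `&` psi i @^-1` dom j) (fun x => sm_trans i j x 0 a);
  trans_point : forall i j x, img i x -> dom j (psi i x) ->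
    is_point (sm_trans i j x);
  trans_base : forall i j x, img i x -> dom j (psi i x) ->
    base (sm_trans i j x) = phi j (psi i x);
  trans_id : forall i x, img i x -> sm_trans i i x = coords m x;
  trans_comp : forall i j k x,
    img i x -> dom j (psi i x) -> dom k (psi i x) ->
    sm_trans i k x = pullmx (sm_trans j k) (sm_trans i j x)
}.

Section SemiRiemannian.
Variables (R : realType) (n m : nat) (M : supermanifold R n m).
Notation C := R[i].
Notation N := (n + m)%N.
Notation G := (gr C m).

Definition trace (i : chart M) (U : set M) : set 'rV[R]_n :=
  img i `&` psi i @^-1` U.

(* d/dx^a = \sum_b (jac i j x a b) d/dy^b, x and y being the coordinates of the
   charts i and j. *)
Definition jac (i j : chart M) (x : 'rV[R]_n) : 'M[G]_N :=
  \matrix_(a, b) spartial a (fun y => sm_trans i j y 0 b) x.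

(* Sections of the complexified structure sheaf over an open U, given over each
   chart.  Over opens contained in one chart the first condition is enough. *)
Definition is_sfun (U : set M) (f : chart M -> 'rV[R]_n -> G) :=
  (forall i, ssmooth (trace i U) (f i)) /\
  (forall i j x, trace i (dom j) x -> U (psi i x) ->
     f i x = pull (f j) (sm_trans i j x)).

Definition body_mx L r s (A : 'M[gr C L]_(r, s)) : 'M[R]_(r, s) :=
  map_mx (fun a => complex.Re (gbody a)) A.

Definition const_gr L r s (A : 'M[R]_(r, s)) : 'M[gr C L]_(r, s) :=
  map_mx (fun a : R => (a%:C)%:A) A.

Record is_metric (g : chart M -> 'rV[R]_n -> 'M[G]_N) : Prop := IsMetric {
  metric_smooth : forall i a b, ssmooth (img i) (fun x => g i x a b);
  metric_even : forall i x a b, img i x -> ghomog (par a (+) par b) (g i x a b);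
  metric_real : forall i x a b, img i x -> greal (g i x a b);
  metric_sym : forall i x a b, img i x ->
    g i x a b = (-1) ^+ (par a && par b) * g i x b a;
  metric_nondegenerate : forall i x, img i x -> body_mx (g i x) \in unitmx;
  metric_trans : forall i j x a b, trace i (dom j) x ->
    g i x a b = gform (pullmx (g j) (sm_trans i j x))
                      (row a (jac i j x)) (row b (jac i j x))
}.

(* The Christoffel symbols in each chart of the torsion-free metric connection.
   They are determined by g, so their transformation law is automatic. *)
Record is_LeviCivita (g : chart M -> 'rV[R]_n -> 'M[G]_N)
    (Gam : chart M -> 'I_N -> 'rV[R]_n -> 'M[G]_N) : Prop := IsLeviCivita {
  LC_smooth : forall i a b c, ssmooth (img i) (fun x => Gam i b x a c);
  LC_even : forall i x a b c, img i x ->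
    ghomog (par a (+) par b (+) par c) (Gam i b x a c);
  LC_real : forall i x a b c, img i x -> greal (Gam i b x a c);
  LC_torsion_free : forall i p q X Y,
    vsmooth (img i) X -> vsmooth (img i) Y ->
    vhomog (img i) p X -> vhomog (img i) q Y ->
    forall x, img i x ->
      nabla (Gam i) X Y x
        - map_mx (GRing.mul ((-1) ^+ (p && q))) (nabla (Gam i) Y X x)
      = bracket p q X Y x;
  LC_metric : forall i p q X Y Z,
    vsmooth (img i) X -> vsmooth (img i) Y -> vsmooth (img i) Z ->
    vhomog (img i) p X -> vhomog (img i) q Y ->
    forall x, img i x ->
      vact X (fun y => gform (g i y) (Y y) (Z y)) x
      = gform (g i x) (nabla (Gam i) X Y x) (Z x)
        + (-1) ^+ (p && q) * gform (g i x) (Y x) (nabla (Gam i) X Z x)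
}.

(* Even endomorphism fields with J^2 = -1, J d_a = \sum_b (J a b) d_b. *)
Record is_almost_complex (J : chart M -> 'rV[R]_n -> 'M[G]_N) : Prop :=
  IsAlmostComplex {
  J_smooth : forall i a b, ssmooth (img i) (fun x => J i x a b);
  J_even : forall i x a b, img i x -> ghomog (par a (+) par b) (J i x a b);
  J_real : forall i x a b, img i x -> greal (J i x a b);
  J_sqr : forall i x, img i x -> J i x *m J i x = - 1%:M;
  J_trans : forall i j x, trace i (dom j) x ->
    jac i j x *m pullmx (J j) (sm_trans i j x) = J i x *m jac i j x
}.

Definition metric_compatible (g J : chart M -> 'rV[R]_n -> 'M[G]_N) :=
  forall i x, img i x -> forall X Y : 'rV[G]_N,
    gform (g i x) (X *m J i x) (Y *m J i x) = gform (g i x) X Y.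

Definition J_parallel (Gam : chart M -> 'I_N -> 'rV[R]_n -> 'M[G]_N)
    (J : chart M -> 'rV[R]_n -> 'M[G]_N) :=
  forall i X Y, vsmooth (img i) X -> vsmooth (img i) Y ->
    forall x, img i x ->
      nabla (Gam i) X (fun y => Y y *m J i y) x = nabla (Gam i) X Y x *m J i x.

(* [curve_smooth e t]: the curve e in a Grassmann algebra is smooth near t. *)
Definition curve_smooth L (e : R -> gr C L) (t : R) :=
  \forall u \near t, forall S k,
    derivable (derive1n k (fun s => complex.Re (gcoef (e s) S))) u 1 /\
    derivable (derive1n k (fun s => complex.Im (gcoef (e s) S))) u 1.

Definition curve_derivable L (e : R -> gr C L) (t : R) := forall S,
  derivable (fun s => complex.Re (gcoef (e s) S)) t 1 /\
  derivable (fun s => complex.Im (gcoef (e s) S)) t 1.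

Definition curve_der L (e : R -> gr C L) (t : R) : gr C L :=
  [ffun S => derive1 (fun s => complex.Re (gcoef (e s) S)) t +i*
             derive1 (fun s => complex.Im (gcoef (e s) S)) t].

Definition curve_continuous L (e : R -> gr C L) (A : set R) (t : R) := forall S,
  (fun s => complex.Re (gcoef (e s) S)) @ within A (nbhs t) -->
    complex.Re (gcoef (e t) S) /\
  (fun s => complex.Im (gcoef (e s) S)) @ within A (nbhs t) -->
    complex.Im (gcoef (e t) S).

(* Piecewise smooth T-loops T x [0,1] -> M at x_T, for T = R^{0|L}: the
   underlying loop in M and, over each chart, its Grassmann-valued coordinates.
   Values outside of [0,1], or of [lc i t] when [lbase t] is outside of the
   chart i, are irrelevant. *)
Record tloop (L : nat) (x : M) := TLoop {
  lbase : R -> M;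
  lc : chart M -> R -> 'rV[gr C L]_N;
  lbreaks : seq R;
  lbase_continuous : {within [set t | 0 <= t <= 1], continuous lbase};
  lbase0 : lbase 0 = x;
  lbase1 : lbase 1 = x;
  lc_point : forall i t, 0 <= t <= 1 -> dom i (lbase t) ->
    is_point (lc i t) /\ base (lc i t) = phi i (lbase t);
  lc_trans : forall i j t, 0 <= t <= 1 -> dom i (lbase t) -> dom j (lbase t) ->
    lc j t = pullmx (sm_trans i j) (lc i t);
  lc0 : forall i, dom i x -> lc i 0 = tpoint m L (phi i x);
  lc1 : forall i, dom i x -> lc i 1 = tpoint m L (phi i x);
  lc_smooth : forall a b : R, 0 <= a -> a < b -> b <= 1 ->
    (forall c, c \in lbreaks -> ~~ (a < c < b)) ->
    forall i t, a <= t <= b -> dom i (lbase t) ->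
      exists e : R -> 'rV[gr C L]_N,
        (forall k, curve_smooth (fun u => e u 0 k) t) /\
        (\forall u \near t, a <= u <= b -> lc i u = e u)
}.

(* [P i t] expresses the parallel transports at time t of a basis at time 0 in
   the frame of the chart i.  The equation is that of parallel fields
   \sum_a X^a (gamma^* d_a) along gamma:
   X^c' + \sum_(a, b) X^a (gamma^b)' gamma^*(Gam_ba^c) = 0. *)
Record is_transport (Gam : chart M -> 'I_N -> 'rV[R]_n -> 'M[G]_N)
    (L : nat) (x : M) (l : tloop L x) (P : chart M -> R -> 'M[gr C L]_N) :
    Prop := IsTransport {
  transport_trans : forall i j t, 0 <= t <= 1 ->
    dom i (lbase l t) -> dom j (lbase l t) ->
    P j t = P i t *m pullmx (jac i j) (lc l i t);
  transport_continuous : forall i t, 0 <= t <= 1 -> dom i (lbase l t) ->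
    forall a c, curve_continuous (fun s => P i s a c) [set s | 0 <= s <= 1] t;
  transport_eq : forall i t, 0 < t < 1 -> t \notin lbreaks l ->
    dom i (lbase l t) -> forall a c,
    curve_derivable (fun s => P i s a c) t /\
    curve_der (fun s => P i s a c) t =
      - \sum_d \sum_b P i t a d * curve_der (fun s => lc l i s 0 b) t
                      * pull (fun y => Gam i b y d c) (lc l i t)
}.

(* Hol_x(T) for T = R^{0|L}; operators on x_T^*(TM) are given by their matrix in
   the coordinate frame of the chart i at x. *)
Definition Hol (Gam : chart M -> 'I_N -> 'rV[R]_n -> 'M[G]_N) (x : M)
    (i : chart M) (L : nat) (Q : 'M[gr C L]_N) :=
  exists (l : tloop L x) (P : chart M -> R -> 'M[gr C L]_N),
    [/\ is_transport Gam l P, P i 0 = 1%:M & P i 1 = Q].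

(* The unitary supergroup over the Grassmann algebra on L generators, of the
   metric with Gram matrix g and the complex structure J on R^{n|m}. *)
Record unitary L (g J : 'M[R]_N) (Q : 'M[gr C L]_N) : Prop := Unitary {
  unitary_even : forall a b, ghomog (par a (+) par b) (Q a b);
  unitary_real : forall a b, greal (Q a b);
  unitary_unit : exists Q', Q *m Q' = 1%:M /\ Q' *m Q = 1%:M;
  unitary_metric : forall X Y,
    gform (const_gr L g) (X *m Q) (Y *m Q) = gform (const_gr L g) X Y;
  unitary_J : Q *m const_gr L J = const_gr L J *m Q
}.

End SemiRiemannian.

Section CalabiYau.
Variables (R : realType) (n m : nat).
Variable M : supermanifold R (n + n) (m + m).
Notation C := R[i].
Notation N := ((n + n) + (m + m))%N.
Notation G := (gr C (m + m)).
Notation tensor2 := (chart M -> 'rV[R]_(n + n) -> 'M[G]_N).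
Notation christoffel := (chart M -> 'I_N -> 'rV[R]_(n + n) -> 'M[G]_N).

(* The rows of E form a homogeneous complex basis of (T_x M, J), so that the rows
   of jmap E form a basis of T^{1,0}_x, and D is the matrix (of left
   coefficients) of jmap o Q o jmap^-1 in that basis. *)
Definition special_unitary L (g J : 'M[R]_N) (Q : 'M[gr C L]_N) :=
  unitary g J Q /\
  exists (E : 'M[R]_(n + m, N)) (D : 'M[gr C L]_(n + m)),
    [/\ forall k a, E k a != 0 -> par k = par a,
        row_free (col_mx E (E *m J)),
        jmap (const_gr L J) (const_gr L E *m Q)
          = D *m jmap (const_gr L J) (const_gr L E)
      & sdet (right_coef D) = 1].

(* J is the parallel extension of the metric-compatible complex structure at the
   point x with respect to which the holonomy is special unitary. *)
Record CalabiYau (g : tensor2) (Gam : christoffel) (J : tensor2) : Prop :=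
  IsCalabiYau {
  CY_J : is_almost_complex J;
  CY_hermitian : metric_compatible g J;
  CY_parallel : J_parallel Gam J;
  CY_holonomy : exists (x : M) (i : chart M), dom i x /\
    forall L (Q : 'M[gr C L]_N), Hol Gam x i Q ->
      special_unitary (body_mx (g i (phi i x))) (body_mx (J i (phi i x))) Q
}.

Definition re_part r (X : 'rV[G]_r) : 'rV[G]_r :=
  map_mx (fun a => (2%:R^-1 : C) *: (a + gconj a)) X.

Definition im_part r (X : 'rV[G]_r) : 'rV[G]_r :=
  map_mx (fun a => ((2%:R * 'i)^-1 : C) *: (a - gconj a)) X.

(* (dmx f x) a l is the derivative of the l-th component of f along d/dx^a. *)
Definition dmx r (f : 'rV[R]_(n + n) -> 'rV[G]_r) (x : 'rV[R]_(n + n)) :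
    'M[G]_(N, r) :=
  \matrix_(a, l) spartial a (fun y => f y 0 l) x.

(* Holomorphic coordinates (xi^k) on an open subset of M: the real and imaginary
   parts of the xi^k form a coordinate system, and J maps the corresponding
   coordinate fields d/dxi^k_R (the rows of [dR]) to d/dxi^k_I (the rows of
   [dI]).  [dR] and [dI] are determined by the duality equations, which express
   the invertibility of the Jacobian. *)
Record hcoord (J : tensor2) := HCoord {
  hdom : set M;
  hdom_open : open hdom;
  xi : chart M -> 'rV[R]_(n + n) -> 'rV[G]_(n + m);
  dR : chart M -> 'rV[R]_(n + n) -> 'M[G]_(n + m, N);
  dI : chart M -> 'rV[R]_(n + n) -> 'M[G]_(n + m, N);
  xi_sfun : forall k, is_sfun hdom (fun i x => xi i x 0 k);
  xi_homog : forall i x k, trace i hdom x -> ghomog (par k) (xi i x 0 k);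
  xi_inj : forall i j (p q : M),
    hdom p -> dom i p -> hdom q -> dom j q ->
    (forall k : 'I_n, gbody (xi i (phi i p) 0 (lshift m k)) =
                      gbody (xi j (phi j q) 0 (lshift m k))) -> p = q;
  dR_re : forall i x, trace i hdom x ->
    dR i x *m dmx (fun y => re_part (xi i y)) x = 1%:M;
  dR_im : forall i x, trace i hdom x ->
    dR i x *m dmx (fun y => im_part (xi i y)) x = 0;
  dI_re : forall i x, trace i hdom x ->
    dI i x *m dmx (fun y => re_part (xi i y)) x = 0;
  dI_im : forall i x, trace i hdom x ->
    dI i x *m dmx (fun y => im_part (xi i y)) x = 1%:M;
  xi_holomorphic : forall i x, trace i hdom x -> dR i x *m J i x = dI i x
}.

Section Local.
Variables (J : tensor2) (h : hcoord J).

Definition d_re (k : 'I_(n + m)) (i : chart M) (x : 'rV[R]_(n + n)) : 'rV[G]_N :=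
  row k (dR h i x).

Definition d_im (k : 'I_(n + m)) (i : chart M) (x : 'rV[R]_(n + n)) : 'rV[G]_N :=
  row k (dI h i x).

Definition d_xi (k : 'I_(n + m)) (i : chart M) (x : 'rV[R]_(n + n)) : 'rV[G]_N :=
  map_mx (GRing.scale (2%:R^-1 : C))
    (d_re k i x - map_mx (GRing.scale 'i) (d_im k i x)).

Definition d_xibar (k : 'I_(n + m)) (i : chart M) (x : 'rV[R]_(n + n)) :
    'rV[G]_N :=
  map_mx (GRing.scale (2%:R^-1 : C))
    (d_re k i x + map_mx (GRing.scale 'i) (d_im k i x)).

(* The coefficient A^q_l in (j nabla_v j^-1) (d/dxi^l) = \sum_q d/dxi^q * A^q_l.
   Here j^-1 (d/dxi^l) = d/dxi^l_R, and the left coefficients of a field of type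
   (1,0) in the frame (d/dxi^q) are its values on the xi^q.  v may be complex. *)
Definition conn_mx (Gam : christoffel) (i : chart M)
    (v : 'rV[R]_(n + n) -> 'rV[G]_N) (x : 'rV[R]_(n + n)) : 'M[G]_(n + m) :=
  right_coef (\matrix_(l, q)
    vact (fun y => jmap (J i y) (nabla (Gam i) v (d_re l i) y))
         (fun y => xi h i y 0 q) x).

(* str (j nabla_v j^-1) for v of parity p. *)
Definition str_conn (Gam : christoffel) (i : chart M) (p : bool)
    (v : 'rV[R]_(n + n) -> 'rV[G]_N) (x : 'rV[R]_(n + n)) : G :=
  str p (conn_mx Gam i v x).

(* A section of Ber M over hdom is f [dxi], f a superfunction.  The connection on
   Ber M with nabla_{d/dxi^k_R} [dxi] = thR k [dxi] and
   nabla_{d/dxi^k_I} [dxi] = thI k [dxi] maps it to (ber_conn thR thI i v f) [dxi]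
   in the direction v = \sum_k v(xi^k_R) d/dxi^k_R + v(xi^k_I) d/dxi^k_I. *)
Definition ber_conn (thR thI : 'I_(n + m) -> chart M -> 'rV[R]_(n + n) -> G)
    (i : chart M) (v : 'rV[R]_(n + n) -> 'rV[G]_N) (f : 'rV[R]_(n + n) -> G)
    (x : 'rV[R]_(n + n)) : G :=
  \sum_k
    (vact v (fun y => re_part (xi h i y) 0 k) x *
       (vact (d_re k i) f x + ginvol (par k) (f x) * thR k i x)
     + vact v (fun y => im_part (xi h i y) 0 k) x *
       (vact (d_im k i) f x + ginvol (par k) (f x) * thI k i x)).

Definition nabla_ber (Gam : christoffel) :=
  ber_conn (fun k i x => - str_conn Gam i (par k) (d_re k i) x)
           (fun k i x => - str_conn Gam i (par k) (d_im k i) x).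

(* Elements of Omega^{0,q} (wedge^p T^{1,0}) over hdom, resp. Omega^{0,q} (I^{n-p}),
   are presented as finite sums of dxibar^I (x) c I ks * d_{ks_1} ^ .. ^ d_{ks_p}
   (resp. followed by (x) [dxi]) with size I = q and size ks = p. *)
Definition polyvector :=
  seq 'I_(n + m) -> seq 'I_(n + m) -> 'rV[R]_(n + n) -> G.

Definition wpar (ks : seq 'I_(n + m)) : bool :=
  odd (\sum_(k <- ks) par k).

(* The operator partial on integral forms.  The coefficient at the word ls
   collects the terms where k has been removed at position r (from 0). *)
Definition partial_int (i : chart M) (c : polyvector) : polyvector :=
  fun I ls x => (-1) ^+ size I *
    \sum_(r < (size ls).+1) \sum_k
      (-1) ^+ (r + (par k && wpar (take r ls)))%N *
      vact (d_xi k i)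
        (fun y => ginvol (par k) (c I (take r ls ++ k :: drop r ls) y)) x.

(* v |-> v (x) omega for omega = f [dxi]; f is moved to the left of the word. *)
Definition ber_eta (f : 'rV[R]_(n + n) -> G) (c : polyvector) : polyvector :=
  fun I ks x => c I ks x * ginvol (wpar ks) (f x).

Definition ber_eta_inv (f : 'rV[R]_(n + n) -> G) (c : polyvector) : polyvector :=
  fun I ks x => c I ks x * ginv (ginvol (wpar ks) (f x)).

Definition Delta_op (i : chart M) (f : 'rV[R]_(n + n) -> G) (c : polyvector) :
    polyvector :=
  ber_eta_inv f (partial_int i (ber_eta f c)).

Definition vec (k : 'I_(n + m)) : polyvector :=
  fun I ks _ => ((I == [::]) && (ks == [:: k]))%:R.

Definition Delta (f : chart M -> 'rV[R]_(n + n) -> G) (k : 'I_(n + m))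
    (i : chart M) (x : 'rV[R]_(n + n)) : G :=
  Delta_op i (f i) (vec k) [::] [::] x.

Definition nabla_Delta (f : chart M -> 'rV[R]_(n + n) -> G) :=
  ber_conn (fun k i x => - Delta f k i x)
           (fun k i x => - ('i *: Delta f k i x)).

End Local.

(* Sections of Ber M: omega = (w h) [dxi] in the holomorphic coordinates h, with
   [dxi] = sdet (d xi / d zeta) [dzeta] under the change of coordinates zeta -> xi. *)
Definition is_ber (J : tensor2)
    (w : hcoord J -> chart M -> 'rV[R]_(n + n) -> G) :=
  (forall h, is_sfun (hdom h) (w h)) /\
  (forall (h h' : hcoord J) i x, trace i (hdom h `&` hdom h') x ->
     w h' i x = w h i x * sdet (right_coef
       (\matrix_(k, l) vact (d_xi h' k i) (fun y => xi h i y 0 l) x))).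

Definition nowhere_vanishing (J : tensor2)
    (w : hcoord J -> chart M -> 'rV[R]_(n + n) -> G) :=
  forall h i x, trace i (hdom h) x -> gbody (w h i x) != 0.

Definition homogeneous (J : tensor2)
    (w : hcoord J -> chart M -> 'rV[R]_(n + n) -> G) :=
  exists p, forall h i x, trace i (hdom h) x -> ghomog p (w h i x).

Definition holomorphic (J : tensor2)
    (w : hcoord J -> chart M -> 'rV[R]_(n + n) -> G) :=
  forall (h : hcoord J) i x k, trace i (hdom h) x ->
    vact (d_xibar h k i) (w h i) x = 0.

Definition ber_parallel (Gam : christoffel) (J : tensor2)
    (w : hcoord J -> chart M -> 'rV[R]_(n + n) -> G) :=
  forall (h : hcoord J) i v, vsmooth (trace i (hdom h)) v ->
    forall x, trace i (hdom h) x -> nabla_ber h Gam i v (w h i) x = 0.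

End CalabiYau.

(* Main.v *)
(* Write omega = w [dxi].  Parallelism in the directions d/dxi^k_R and d/dxi^k_I
   says that d_R w = w str(nabla_R) and d_I w = w str(nabla_I), while holomorphy
   says that d_I w = i d_R w.  Since w is even and invertible, this gives
   str(nabla_I) = i str(nabla_R), and Delta(d/dxi^k) = (dw/dxi^k) w^-1 equals
   str(nabla_R), which is also str(nabla_{d/dxi^k}) by complex linearity. *)

Require Import Defs.
From HB Require Import structures.
From mathcomp Require Import all_boot all_order all_algebra.

Import GRing.Theory.

Local Open Scope ring_scope.

(** * Signs, commutation and inverses in the Grassmann algebra *)

Section Grassmann.
Variables (K : fieldType) (L : nat).
Implicit Types (a b : gr K L) (S A B : {set 'I_L}).

Lemma gcoef0 S : gcoef (0 : gr K L) S = 0.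
Proof. by rewrite /gcoef ffunE. Qed.

Lemma gcoef_ginvol p a S :
  gcoef (ginvol p a) S = (-1) ^+ (p && odd #|S|) * gcoef a S.
Proof. by rewrite /gcoef ffunE. Qed.

Lemma ginvolK p : involutive (@ginvol K L p).
Proof.
by move=> a; apply: grP => S; rewrite !gcoef_ginvol mulrA -expr2 sqrr_sign mul1r.
Qed.

Lemma ginvol_false a : ginvol false a = a.
Proof. by apply: grP => S; rewrite gcoef_ginvol mul1r. Qed.

Lemma ginvol0 p : ginvol p (0 : gr K L) = 0.
Proof. by apply: grP => S; rewrite gcoef_ginvol gcoef0 mulr0. Qed.

Lemma ginvol_comb p c1 c2 a b :
  ginvol p (c1 *: a + c2 *: b) = c1 *: ginvol p a + c2 *: ginvol p b.
Proof.
apply: grP => S; rewrite gcoef_ginvol !gcoefD !gcoefZ !gcoef_ginvol mulrDr.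
by rewrite mulrCA [in X in _ + X]mulrCA.
Qed.

Lemma sum_mul_comb (I : finType) c1 c2 (X X1 X2 F : I -> gr K L) :
  (forall i, X i = c1 *: X1 i + c2 *: X2 i) ->
  \sum_i X i * F i = c1 *: \sum_i X1 i * F i + c2 *: \sum_i X2 i * F i.
Proof.
move=> hX; rewrite 2!scaler_sumr -[RHS]big_split; apply: eq_bigr => i _ /=.
by rewrite hX mulrDl -2!scalerAl.
Qed.

Lemma str_comb n m p c1 c2 (A A1 A2 : 'M[gr K L]_(n + m)) :
  (forall q, A q q = c1 *: A1 q q + c2 *: A2 q q) ->
  str p A = c1 *: str p A1 + c2 *: str p A2.
Proof.
move=> hA; rewrite /str 2!scaler_sumr -[RHS]big_split; apply: eq_bigr => q _ /=.
by rewrite hA 2!scalerAr -mulrDr.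
Qed.

Lemma mulmx_comb r s t c1 c2 (X X1 X2 : 'M[gr K L]_(r, s)) (A : 'M_(s, t)) i j :
  (forall k, X i k = c1 *: X1 i k + c2 *: X2 i k) ->
  (X *m A) i j = c1 *: (X1 *m A) i j + c2 *: (X2 *m A) i j.
Proof.
move=> hX; have := sum_mul_comb _ c1 c2 (X i) (X1 i) (X2 i) (A^~ j) hX.
by rewrite !mxE.
Qed.

Lemma ginvol_even p a : ghomog false a -> ginvol p a = a.
Proof.
move=> ha; apply: grP => S; rewrite gcoef_ginvol.
have [->|/ha->] := eqVneq (gcoef a S) 0; first by rewrite mulr0.
by rewrite andbF mul1r.
Qed.

(** The body is the coefficient at the empty set, which has even cardinality. *)
Lemma ghomog_unit_even p a : ghomog p a -> gbody a != 0 -> p = false.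
Proof. by move=> hp /hp; rewrite cards0. Qed.

(** A pair in A x B has distinct entries, so it is an inversion in exactly one of the two orders. *)
Lemma inversionsC A B : [disjoint A & B] ->
  (inversions A B + inversions B A = #|A| * #|B|)%N.
Proof.
move=> dAB; rewrite /inversions [X in (_ + X)%N]exchange_big -big_split /=.
rewrite -sum_nat_const; apply: eq_bigr => i iA.
rewrite -big_split -sum1_card; apply: eq_bigr => j jB /=.
have: i != j by apply: contraTneq jB => <-; rewrite (disjointFr dAB iA).
by rewrite -val_eqE /=; case: ltngtP.
Qed.

Lemma even_central a b : ghomog false a -> a * b = b * a.
Proof.
move=> ha; apply: grP => S; rewrite [LHS]gcoefM [RHS]gcoefM.
(* Passing to complements in S swaps the two factors, so the sums match term by term up to sign. *)
rewrite [RHS](reindex_onto (fun A => S :\: A) (fun A => S :\: A)) /=; last first.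
  by move=> A sAS; rewrite setDDr setDv set0U; apply/setIidPr.
apply: eq_big => [A|A sAS].
  rewrite subDset subsetUr setDDr setDv set0U /=.
  by apply/idP/eqP => [/setIidPr|<-]; rewrite ?subsetIl.
rewrite setDDr setDv set0U (setIidPr sAS).
have [->|/ha eA] := eqVneq (gcoef a A) 0; first by rewrite !(mulr0, mul0r).
rewrite -!mulrA [gcoef b _ * _]mulrC; congr (_ * _).
have dA : [disjoint A & S :\: A] by exact: disjoint_setD.
(* The two inversion numbers add up to |A| |S \ A|, which is even because |A| is, so the signs
   agree. *)
have := congr1 odd (inversionsC _ _ dA); rewrite oddD oddM eA /=.
by move=> /eqP; rewrite -[RHS]signr_odd -signr_odd; case: odd; case: odd.
Qed.

(** Since [gnil a] has zero body, each factor raises the degree by at least one. *)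
Lemma gnil_expr_coef a k S : (#|S| < k)%N -> gcoef (gnil a ^+ k) S = 0.
Proof.
elim: k S => // k IHk S leSk; rewrite exprSr gcoefM big1 // => A sAS.
have [eA|ltA] := eqVneq A S.
  rewrite eA setDv [X in _ * X](_ : _ = 0) ?mulr0 // /gnil /gcoef !ffunE.
  by rewrite /gbody /gcoef eqxx [_ *: _]mulr1 subrr.
rewrite IHk ?mulr0 ?mul0r //; apply: leq_trans (leSk : (#|S| <= k)%N).
by apply: proper_card; rewrite properEneq ltA.
Qed.

Lemma gnil_nilpotent a : gnil a ^+ L.+1 = 0.
Proof.
apply: grP => S; rewrite gnil_expr_coef ?gcoef0 //.
by rewrite ltnS -[X in (_ <= X)%N]card_ord max_card.
Qed.

(** Factor a as its body times 1 - u with u nilpotent; the geometric series in u then telescopes to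
    1 - u^(L+1) = 1. *)
Lemma mulr_ginv a : gbody a != 0 -> a * ginv a = 1.
Proof.
move=> a0; pose u : gr K L := - (gbody a)^-1 *: gnil a.
have -> : ginv a = (gbody a)^-1 *: \sum_(k < L.+1) u ^+ k.
  rewrite scaler_sumr; apply: eq_bigr => k _.
  by rewrite /u scaleNr -scalerN exprZn scalerA exprS.
have Ea : a = gbody a *: (1 - u).
  rewrite /u scaleNr opprK scalerDr scalerA mulfV // scale1r.
  by rewrite /gnil addrC subrK.
rewrite {1}Ea -scalerAl -scalerAr !scalerA mulfV // scale1r.
apply: oppr_inj; rewrite -mulNr opprB -subrX1 /u scaleNr -scalerN exprZn.
by rewrite exprNn gnil_nilpotent mulr0 scaler0 sub0r.
Qed.

(** The value on (d_R - i d_I)/2 of a complex-linear expression that is a on d_R and i a on d_I. *)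
Lemma scale_half_comb (i : K) a : 2 != 0 :> K -> i * i = -1 ->
  2^-1 *: a + (- (2^-1 * i)) *: (i *: a) = a.
Proof.
move=> two_neq0 ii; rewrite scalerA mulNr -mulrA ii mulrN1 opprK -scalerDl.
by rewrite -[2^-1]mulr1 -mulrDr mulVf // scale1r.
Qed.

(** The argument at a single point: [a] is the coefficient of omega, [dR] and [dI] are its
    derivatives, [sR] and [sI] the supertraces. The last three hypotheses express parallelism in the
    two real directions and holomorphy. *)
Lemma holomorphic_log_deriv p (i : K) a dR dI sR sI :
  2 != 0 :> K -> i * i = -1 -> ghomog false a -> gbody a != 0 ->
  dR + ginvol p a * - sR = 0 -> dI + ginvol p a * - sI = 0 ->
  2^-1 *: dR + (2^-1 * i) *: dI = 0 ->
  sI = i *: sR /\ (2^-1 *: dR + (- (2^-1 * i)) *: dI) * ginv a = sR.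
Proof.
move=> two_neq0 ii a_even a_unit; rewrite ginvol_even // 2!mulrN.
move=> /subr0_eq -> /subr0_eq -> /eqP.
rewrite -scalerA -scalerDr scaler_eq0 invr_eq0 (negPf two_neq0) /= => /eqP hol.
have aV := mulr_ginv a a_unit.
have aK s : a * s * ginv a = s by rewrite (even_central a s a_even) -mulrA aV mulr1.
(* Holomorphy now reads a sR + i (a sI) = 0; multiply by i. *)
have eI : a * sI = i *: (a * sR).
  apply/eqP; rewrite -subr_eq0 -[X in X - _]opprK -[a * sI]scale1r.
  by rewrite -scaleNr -ii -scalerA -opprD -scalerDr addrC hol scaler0 oppr0.
split; first by rewrite -[LHS]aK eI -scalerAl aK.
by rewrite eI scale_half_comb.
Qed.

End Grassmann.

From mathcomp Require Import boolp classical_sets functions reals topology.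
From mathcomp Require Import normedtype derive.
From mathcomp Require Import complex.

Import Order.TTheory GRing.Theory Num.Theory.
Import numFieldNormedType.Exports.

Local Open Scope ring_scope.
Local Open Scope classical_set_scope.
Local Open Scope complex_scope.

(** * Constant functions and constant vector fields *)

Section Constant.
Variables (R : realType) (n m : nat).

Lemma rsmooth_cst (V : set 'rV[R]_n) (c : R) : rsmooth V (fun _ => c).
Proof.
(* Every iterated partial derivative is again constant. *)
move=> s x _; have [d ->] : exists d, rpartials s (fun _ => c) = fun _ => d.
  elim: s => [|i s [d ds]]; first by exists c.
  exists 0; rewrite /rpartials /= -/(rpartials _ _) ds.
  by apply/funext => y; rewrite /rpartial derive1_cst.
by split=> [|i]; [exact: cst_continuous | exact: derivable_cst].
Qed.

Lemma vsmooth_cst (V : set 'rV[R]_n) (X : 'rV[gr R[i] m]_(n + m)) :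
  vsmooth V (fun _ => X).
Proof. by move=> a S; split; exact: rsmooth_cst. Qed.

Lemma spartial0 (a : 'I_(n + m)) (x : 'rV[R]_n) :
  spartial a (fun _ => 0 : gr R[i] m) x = 0.
Proof.
rewrite /spartial; case: fintype.split => [i|j]; apply: grP => S.
  rewrite gcoef0 {1}/gcoef ffunE /cpartial /rpartial.
  under [in X in X +i* _]eq_fun do rewrite gcoef0.
  under [in X in _ +i* X]eq_fun do rewrite gcoef0.
  by rewrite !derive1_cst.
by rewrite gcoef0 {1}/gcoef ffunE gcoef0 mulr0 if_same.
Qed.

End Constant.

(** * Complex linearity in the direction, and evaluation on coordinate fields *)

Section ComplexLinearity.
Variables (R : realType).
Notation C := R[i].

(** The direction is never differentiated, so a relation at the single point x suffices. *)
Lemma vact_comb n m (c1 c2 : C) (X X1 X2 : 'rV[R]_n -> 'rV[gr C m]_(n + m)) F x :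
  (forall a, X x 0 a = c1 *: X1 x 0 a + c2 *: X2 x 0 a) ->
  vact X F x = c1 *: vact X1 F x + c2 *: vact X2 F x.
Proof. exact: sum_mul_comb. Qed.

Lemma nabla_comb n m (c1 c2 : C) Gam (X X1 X2 Y : 'rV[R]_n -> 'rV[gr C m]_(n + m)) x :
  (forall a, X x 0 a = c1 *: X1 x 0 a + c2 *: X2 x 0 a) ->
  forall a, nabla Gam X Y x 0 a = c1 *: nabla Gam X1 Y x 0 a + c2 *: nabla Gam X2 Y x 0 a.
Proof. by move=> hX a; rewrite !mxE; exact: sum_mul_comb. Qed.

Lemma jmap_comb N L (c1 c2 : C) (J : 'M[gr C L]_N) (X X1 X2 : 'rV[gr C L]_N) :
  (forall a, X 0 a = c1 *: X1 0 a + c2 *: X2 0 a) ->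
  forall a, jmap J X 0 a = c1 *: jmap J X1 0 a + c2 *: jmap J X2 0 a.
Proof.
move=> hX a; pose f (x y : gr C L) := (2^-1 : C) *: (x - 'i *: y).
have E (Y : 'rV[gr C L]_N) : jmap J Y 0 a = f (Y 0 a) ((Y *m J) 0 a).
  rewrite /jmap mxE; congr (_ *: _); rewrite mxE; congr (_ + _).
  by rewrite mxE; congr (- _); exact: mxE.
have fD x1 x2 y1 y2 : f (c1 *: x1 + c2 *: x2) (c1 *: y1 + c2 *: y2) =
    c1 *: f x1 y1 + c2 *: f x2 y2.
  rewrite /f 2!scalerA [c1 * _]mulrC [c2 * _]mulrC -2!scalerA -scalerDr.
  congr (_ *: _).
  rewrite 3!scalerDr 2!scalerN 4!scalerA opprD ['i * c1]mulrC ['i * c2]mulrC.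
  by rewrite addrACA.
have hXJ : (X *m J) 0 a = c1 *: (X1 *m J) 0 a + c2 *: (X2 *m J) 0 a.
  exact: mulmx_comb.
(* Rewriting with [E] instead makes unification unfold the matrix products. *)
exact: etrans (E X) (etrans (congr2 f (hX a) hXJ) (etrans (fD _ _ _ _) (esym
  (congr2 (fun x y => c1 *: x + c2 *: y) (E X1) (E X2))))).
Qed.

Variables (n m : nat) (M : supermanifold R (n + n) (m + m)).
Notation G := (gr C (m + m)).
Notation N := ((n + n) + (m + m))%N.
Variables (J : chart M -> 'rV[R]_(n + n) -> 'M[G]_N) (h : hcoord J).

(** Covariant derivative, [jmap], evaluation on the coordinates, [ginvol] and supertrace are each
    complex linear, the parity [p] being common to all three directions. *)
Lemma str_conn_comb (c1 c2 : C) Gam i p (v v1 v2 : 'rV[R]_(n + n) -> 'rV[G]_N) x :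
  (forall a, v x 0 a = c1 *: v1 x 0 a + c2 *: v2 x 0 a) ->
  str_conn h Gam i p v x =
  c1 *: str_conn h Gam i p v1 x + c2 *: str_conn h Gam i p v2 x.
Proof.
move=> hv; apply: str_comb => q.
have E u : conn_mx h Gam i u x q q = ginvol (par q)
    (vact (fun y => jmap (J i y) (nabla (Gam i) u (d_re h q i) y))
          (fun y => xi h i y 0 q) x).
  by rewrite [LHS]mxE; congr ginvol; exact: mxE.
have vactD F :
    vact (fun y => jmap (J i y) (nabla (Gam i) v (d_re h q i) y)) F x =
    c1 *: vact (fun y => jmap (J i y) (nabla (Gam i) v1 (d_re h q i) y)) F x +
    c2 *: vact (fun y => jmap (J i y) (nabla (Gam i) v2 (d_re h q i) y)) F x.
  by apply: vact_comb; apply: jmap_comb; apply: nabla_comb.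
have lhsE := etrans (E v) (etrans (congr1 (ginvol (par q)) (vactD _))
  (ginvol_comb _ _ (par q) _ _ _ _)).
have rhsE := congr2 (fun a b => c1 *: a + c2 *: b) (E v1) (E v2).
exact: etrans lhsE (esym rhsE).
Qed.

Lemma d_xi_comb k i x a : d_xi h k i x 0 a =
  2^-1 *: d_re h k i x 0 a + (- (2^-1 * 'i)) *: d_im h k i x 0 a.
Proof.
rewrite /d_xi mxE scaleNr -scalerA -scalerN -scalerDr; congr (_ *: _).
by rewrite mxE; congr (_ + _); rewrite mxE; congr (- _); exact: mxE.
Qed.

Lemma d_xibar_comb k i x a : d_xibar h k i x 0 a =
  2^-1 *: d_re h k i x 0 a + (2^-1 * 'i) *: d_im h k i x 0 a.
Proof.
rewrite /d_xibar mxE -scalerA -scalerDr; congr (_ *: _).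
by rewrite mxE; congr (_ + _); exact: mxE.
Qed.

(** Brings derivatives of coordinates into the form of the duality equations of [hcoord]. *)
Lemma vact_row r s (B : 'M[G]_(s, N)) (F : 'rV[R]_(n + n) -> 'rV[G]_r) k l x :
  vact (fun _ => row k B) (fun y => F y 0 l) x = (B *m dmx F x) k l.
Proof. by rewrite [RHS]mxE; apply: eq_bigr => a _; congr (_ * _); rewrite mxE. Qed.

(** By duality only the k-th real coordinate has nonzero derivative along this direction, so one
    term of the sum survives. *)
Lemma ber_conn_d_re thR thI i k f x : trace i (hdom h) x ->
  ber_conn h thR thI i (fun _ => d_re h k i x) f x =
  vact (d_re h k i) f x + ginvol (par k) (f x) * thR k i x.
Proof.
move=> hx; rewrite /ber_conn.
have ERe l := vact_row _ _ (dR h i x) (fun y => re_part (xi h i y)) k l x.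
have EIm l := vact_row _ _ (dR h i x) (fun y => im_part (xi h i y)) k l x.
rewrite (bigD1 k) //= big1 => [|l lk].
  by rewrite ERe EIm (dR_re hx) (dR_im hx) !mxE eqxx mul1r mul0r !addr0.
by rewrite ERe EIm (dR_re hx) (dR_im hx) !mxE eq_sym (negPf lk) !mul0r addr0.
Qed.

Lemma ber_conn_d_im thR thI i k f x : trace i (hdom h) x ->
  ber_conn h thR thI i (fun _ => d_im h k i x) f x =
  vact (d_im h k i) f x + ginvol (par k) (f x) * thI k i x.
Proof.
move=> hx; rewrite /ber_conn.
have ERe l := vact_row _ _ (dI h i x) (fun y => re_part (xi h i y)) k l x.
have EIm l := vact_row _ _ (dI h i x) (fun y => im_part (xi h i y)) k l x.
rewrite (bigD1 k) //= big1 => [|l lk].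
  by rewrite ERe EIm (dI_re hx) (dI_im hx) !mxE eqxx mul1r mul0r add0r !addr0.
by rewrite ERe EIm (dI_re hx) (dI_im hx) !mxE eq_sym (negPf lk) !mul0r addr0.
Qed.

(** Only the insertion of k into the empty word contributes, and the sign from moving w past d/dxi^k
    in [ber_eta] cancels the one in [partial_int]. *)
Lemma DeltaE (w : chart M -> 'rV[R]_(n + n) -> G) k i x :
  Delta h w k i x = vact (d_xi h k i) (w i) x * ginv (w i x).
Proof.
rewrite /Delta /Delta_op /ber_eta_inv /partial_int /wpar big_nil ginvol_false.
congr (_ * _); rewrite big_ord_recl big_ord0 addr0 mul1r /= (bigD1 k) //= big1.
  rewrite addr0 andbF mul1r; congr (vact _ _ x); apply/funext => y.
  rewrite /ber_eta /vec !eqxx mul1r /wpar big_seq1 oddb.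
  exact: ginvolK.
move=> l lk; rewrite andbF mul1r /vact big1 // => a _.
rewrite (_ : (fun y => _) = fun _ => 0); last first.
  apply/funext => y; rewrite /ber_eta /vec eqseq_cons (negPf lk) mul0r.
  exact: ginvol0.
by rewrite spartial0 mulr0.
Qed.

End ComplexLinearity.

(** * Comparison of the two connections on the Berezinian *)

Theorem theorem1p2 (R : realType) (n m : nat)
    (M : supermanifold R (n + n) (m + m))
    (M_connected : connected [set: M])
    (g : chart M -> 'rV[R]_(n + n) ->
         'M[gr R[i] (m + m)]_((n + n) + (m + m)))
    (Gam : chart M -> 'I_((n + n) + (m + m)) -> 'rV[R]_(n + n) ->
           'M[gr R[i] (m + m)]_((n + n) + (m + m)))
    (J : chart M -> 'rV[R]_(n + n) ->
         'M[gr R[i] (m + m)]_((n + n) + (m + m)))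
    (g_metric : is_metric g)
    (Gam_LC : is_LeviCivita g Gam)
    (M_CY : CalabiYau g Gam J)
    (w : hcoord J -> chart M -> 'rV[R]_(n + n) -> gr R[i] (m + m))
    (w_ber : is_ber w)
    (w_nowhere_vanishing : nowhere_vanishing w)
    (w_homogeneous : homogeneous w)
    (w_holomorphic : holomorphic w)
    (w_parallel : ber_parallel Gam w) :
  (forall (h : hcoord J) (i : chart M) (V : set 'rV[R]_(n + n)),
     open V -> V `<=` trace i (hdom h) ->
     forall (v : 'rV[R]_(n + n) -> 'rV[gr R[i] (m + m)]_((n + n) + (m + m)))
            (f : 'rV[R]_(n + n) -> gr R[i] (m + m)),
       vsmooth V v -> ssmooth V f ->
       forall x : 'rV[R]_(n + n), V x ->
         nabla_ber h Gam i v f x = nabla_Delta h (w h) i v f x)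
  /\
  (forall (h : hcoord J) (k : 'I_(n + m)) (i : chart M) (x : 'rV[R]_(n + n)),
     trace i (hdom h) x ->
     Delta h (w h) k i x = str_conn h Gam i (par k) (d_xi h k i) x).
Proof.
have two_neq0 : 2 != 0 :> R[i] by rewrite pnatr_eq0.
have ii : 'i * 'i = -1 :> R[i] by rewrite -expr2 sqr_i.
have key h i x k : trace i (hdom h) x ->
    str_conn h Gam i (par k) (d_im h k i) x =
      'i *: str_conn h Gam i (par k) (d_re h k i) x /\
    Delta h (w h) k i x = str_conn h Gam i (par k) (d_re h k i) x.
  move=> hx.
  have w_unit := w_nowhere_vanishing h i x hx.
  (* An invertible homogeneous value can only be even. *)
  have w_even : ghomog false (w h i x).
    have [p /(_ h i x hx) hp] := w_homogeneous.
    by rewrite -(ghomog_unit_even _ _ _ _ hp w_unit).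
  (* Only the value of the direction at [x] matters, so constant fields suffice. *)
  have eR := etrans (esym (ber_conn_d_re _ _ _ _ _ _ _ _ _ _ _ _ hx))
    (w_parallel h i _ (vsmooth_cst _ _ _ _ (d_re h k i x)) x hx).
  have eI := etrans (esym (ber_conn_d_im _ _ _ _ _ _ _ _ _ _ _ _ hx))
    (w_parallel h i _ (vsmooth_cst _ _ _ _ (d_im h k i x)) x hx).
  have hol := etrans (esym (vact_comb _ _ _ _ _ _ _ _ (w h i) _
    (d_xibar_comb _ _ _ _ _ h k i x))) (w_holomorphic h i x k hx).
  have [sI sR] :=
    holomorphic_log_deriv _ _ _ _ _ _ _ _ _ two_neq0 ii w_even w_unit eR eI hol.
  split; first exact: sI.
  apply: etrans (DeltaE _ _ _ _ _ h (w h) k i x) _.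
  apply: etrans sR; congr (_ * _).
  exact: vact_comb (d_xi_comb _ _ _ _ _ h k i x).
split=> [h i V oV sV v f _ _ x /sV hx|h k i x hx].
  (* Both connections come from one formula, so it is enough to match their values on [dxi] in the
     real coordinate directions. *)
  rewrite /nabla_ber /nabla_Delta /ber_conn; apply: eq_bigr => k _.
  by have [-> ->] := key h i x k hx.
have [eI eD] := key h i x k hx.
(* Expand the supertrace along d/dxi^k = (d_R - i d_I)/2; with [eI] the two halves add up to the
   supertrace along d_R. *)
have e := str_conn_comb _ _ _ _ _ h _ _ Gam i (par k) _ _ _ _
  (d_xi_comb _ _ _ _ _ h k i x).
have half := scale_half_comb _ _ _
  (str_conn h Gam i (par k) (d_re h k i) x) two_neq0 ii.
have := etrans e (etrans (congr1 _ (congr1 _ eI)) half).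
by move/esym/(etrans eD).
Qed.
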